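(* Let $q$ be a prime power, $h\ge 2$, $1\le r_0\le h$, and $r=h+r_0$. Let $N$ be the maximum cardinality of a partial $r_0$-spread of $\mathbb{F}_q^r$. Then there exists a QMDS additive $[N,1+r_0/h,d]_q^h$ code. Moreover, writing $N=q^h+f(q)$ and $h=ar_0+b$ with integers $a\ge 1$ and $0\le b\le r_0-1$, one has $$f(q)\ \ge\ \sum_{i=1}^{a-1}q^{ir_0+b}+1,$$ and if $r_0\mid h$ then $$f(q)=\sum_{i=1}^{a-1}q^{ir_0}+1=\frac{q^h-1}{q^{r_0}-1}.$$
   Context: A partial $t$-spread of $\mathbb{F}_q^r$ is a collection of $t$-dimensional $\mathbb{F}_q$-subspaces of $\mathbb{F}_q^r$ any two distinct members of which intersect only in $0$. An additive $[n,r/h,d]_q^h$ code is an $\mathbb{F}_q$-linear subspace $C\subseteq\mathbb{F}_{q^h}^n$ with $\dim_{\mathbb{F}_q}C=r$ and minimum Hamming distance $d=\min\{\mathrm{wt}(c):c\in C\setminus\{0\}\}$, where $\mathrm{wt}(c)$ is the number of nonzero coordinates of $c$. It is called QMDS (quasi-MDS) if $d=n-\lceil r/h\rceil+1$. *)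

(* Defs.v *)
From HB Require Import structures.
From mathcomp Require Import all_boot all_order all_algebra all_field.
From mathcomp Require Import finmap.

Set Implicit Arguments.
Unset Strict Implicit.
Unset Printing Implicit Defensive.

Import Order.TTheory GRing.Theory Num.Theory.
Local Open Scope ring_scope.

(* A collection of subspaces of F^r is an {fset _}: F is finite, so every
   collection of subspaces is finite. *)
Definition partial_spread (F : finFieldType) (r t : nat)
    (S : {fset {vspace 'rV[F]_r}}) : Prop :=
  (forall U, U \in S -> \dim U = t) /\
  (forall U W, U \in S -> W \in S -> U != W -> (U :&: W)%VS = 0%VS).

Definition max_partial_spread_size (F : finFieldType) (r t N : nat) : Prop :=
  (exists S : {fset {vspace 'rV[F]_r}}, partial_spread t S /\ #|` S| = N) /\
  (forall S : {fset {vspace 'rV[F]_r}}, partial_spread t S -> (#|` S| <= N)%N).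

Definition wt (L : fieldType) (n : nat) (c : {ffun 'I_n -> L}) : nat :=
  #|[set i | c i != 0]|.

(* Words are finite functions rather than row vectors because
   {ffun 'I_n -> L} is a vector space over the base field F of L, so that its
   {vspace _} are the F-linear subspaces of L^n and \dim is over F. *)
Definition min_distance (F : finFieldType) (L : fieldExtType F) (n : nat)
    (C : {vspace {ffun 'I_n -> L}}) (d : nat) : Prop :=
  (exists c, [/\ c \in C, c != 0 & wt c = d]) /\
  (forall c, c \in C -> c != 0 -> (d <= wt c)%N).

(* C is an additive [n, r/h, d]_q^h code, for q = #|F| and h = [L : F]. *)
Definition additive_code (F : finFieldType) (L : fieldExtType F) (n r d : nat)
    (C : {vspace {ffun 'I_n -> L}}) : Prop :=
  \dim C = r /\ min_distance C d.

Definition QMDS (n r h d : nat) : Prop :=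
  d%:Z = n%:Z - Num.ceil (r%:R / h%:R : rat) + 1.

(* Main.v *)
Require Import Defs.
From HB Require Import structures.
From mathcomp Require Import all_boot all_order all_algebra all_field.
From mathcomp Require Import fingroup cyclic finmap.

Set Implicit Arguments.
Unset Strict Implicit.
Unset Printing Implicit Defensive.

Import Order.TTheory GRing.Theory Num.Theory.
Local Open Scope ring_scope.

(* Given a partial r0-spread of F^r with r = h + r0, choose for each member U a
   linear map phi_U : F^r -> L with kernel U.  The word of v is (phi_U v)_U; its
   zeros are the members containing v, so a nonzero v yields at most one zero.

   A large partial spread is grown by repeatedly adding r0 dimensions: inside
   V0 + V1 with dim V1 = r0, the graphs of the maps V1 -> V0 given by the
   multiplications of a field of size |V0| are |V0| subspaces that meet V0 and
   each other trivially.  The upper bound counts nonzero vectors. *)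

(** * Finite field extensions and linear maps *)

(** The splitting field of X^Q - X with Q = #|F|^m works. The polynomial is separable, its
    derivative being -1, so it has Q roots; these form a subfield, which is therefore everything. *)
Lemma finField_ext_exists (F : finFieldType) (m : nat) :
  (0 < m)%N -> exists K : fieldExtType F, \dim {:K} = m.
Proof.
move=> m_gt0; pose Q := (#|F| ^ m)%N.
have Q_gt1 : (1 < Q)%N by rewrite (ltn_exp2l 0) ?finNzRing_gt1.
pose q (R : nzRingType) : {poly R} := 'X^Q - 'X.
have size_q (R : nzRingType) : size (q R) = Q.+1.
  by rewrite size_polyDl size_polyXn // size_polyN size_polyX.
have q_neq0 : q F != 0 by rewrite -size_poly_eq0 size_q.
have [/= L] := FinSplittingFieldFor q_neq0.
rewrite rmorphB /= map_polyXn map_polyX -/(q L) => -[zs DqL defL].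
have Q0 : Q%:R = 0 :> L.
  have F0 : #|F|%:R = 0 :> F.
    by apply/eqP; rewrite -FinRing.zmodXgE -order_dvdn -cardsT order_dvdG ?inE.
  rewrite /Q natrX -(rmorph_nat (in_alg L)) F0 rmorph0 expr0n.
  by rewrite -[m]prednK.
have Uzs : uniq zs.
  rewrite -separable_prod_XsubC -(eqp_separable DqL) separable_poly.unlock.
  rewrite derivB derivXn derivX -mulr_natr -polyC_natr Q0 mulr0 sub0r.
  by rewrite -scaleN1r coprimepZr ?oppr_eq0 ?oner_eq0 // coprimep1.
have size_zs : size zs = Q.
  by apply: succn_inj; rewrite -(size_prod_XsubC _ id) -(eqp_size DqL) size_q.
have /finField_galois_generator[/= a _ Da] : (1 <= {:L})%VS by apply: sub1v.
rewrite dimv1 expn1 in Da.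
(* The generator [a] is x |-> x^#|F|, so its m-th power is x |-> x^Q, and its fixed points are the
   roots of X^Q - X. *)
pose E := fixedSpace (a ^+ m)%g.
have in_zs : zs =i E.
  move=> z; rewrite -root_prod_XsubC -(eqp_root DqL) (sameP fixedSpaceP eqP).
  rewrite /root !hornerE subr_eq0 /Q; congr (_ == z).
  elim: (m) => [|i IHi]; first by rewrite gal_id.
  by rewrite expgSr expnSr exprM IHi galM ?Da ?memvf.
have defE : E = {:L}%VS.
  apply/eqP; rewrite eqEsubv subvf -defL -[E]subfield_closed agenvS //.
  by rewrite subv_add sub1v; apply/span_subvP=> z; rewrite in_zs.
exists L; apply: (expnI (finNzRing_gt1 F)).
rewrite -[RHS]size_zs -(@card_vspace F (finvect_type L)).
rewrite -(@card_uniqP (finvect_type L) zs Uzs).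
by apply: eq_card => z; rewrite in_zs defE.
Qed.

(** Project along [U] onto a complement, then send a basis [X] of the complement to a basis [Y] of
    [W]; the dimension hypothesis gives both bases the same length. *)
Lemma exists_hom_lker_limg (F : fieldType) (aT rT : vectType F)
    (U : {vspace aT}) (W : {vspace rT}) :
  (\dim U + \dim W = \dim {:aT})%N ->
  exists f : 'Hom(aT, rT), lker f = U /\ limg f = W.
Proof.
move=> dimUW.
have dimUC : \dim U^C = \dim W by rewrite dimv_compl -dimUW addKn.
pose X := vbasis U^C; pose Y := vbasis W.
pose f0 v := \sum_(i < \dim U^C) coord X i (v - projv U v) *: Y`_i.
have f0_lin : linear f0.
  move=> k u v; rewrite /f0 scaler_sumr -big_split /=; apply: eq_bigr => i _.
  by rewrite linearP opprD addrACA -scalerN -scalerDr linearP scalerDl scalerA.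
pose f := linfun (HB.pack_for {linear aT -> rT} f0
  (GRing.isLinear.Build _ _ _ _ f0 f0_lin)).
have fE v : f v = f0 v by rewrite lfunE.
have kerf : lker f = U.
  apply/vspaceP => v; rewrite memv_ker fE; apply/eqP/idP => [fv0|Uv].
    have freeY := basis_free (vbasisP W).
    have cY i : coord X i (v - projv U v) = 0.
      move/freeP: (freeY) => /(_ (fun j => coord X (cast_ord (esym dimUC) j) (v - projv U v))).
      move=> /(_ _ (cast_ord dimUC i)); rewrite cast_ordK; apply.
      rewrite -[RHS]fv0 /f0 (reindex (cast_ord (esym dimUC))) //=.
      by exists (cast_ord dimUC) => j _; rewrite ?cast_ordK ?cast_ordKV.
    have : v - projv U v = 0.
      rewrite (coord_vbasis (memv_projC U v)); apply: big1 => i _.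
      by rewrite cY scale0r.
    by move/eqP; rewrite subr_eq0 => /eqP ->; apply: memv_proj.
  by rewrite /f0 projv_id // subrr; apply: big1 => i _; rewrite linear0 scale0r.
exists f; split=> //; apply/eqP; rewrite eqEdim; apply/andP; split.
  apply/subvP => _ /memv_imgP[v _ ->]; rewrite fE; apply: rpred_sum => i _.
  by rewrite rpredZ // vbasis_mem // mem_nth // size_tuple -dimUC.
by have := limg_ker_dim f fullv; rewrite capfv kerf -dimUW => /addnI ->.
Qed.

(** * Partial spreads: counting and construction *)

(** The ambient space is a subspace [V], not a whole type, so that the induction on dimension stays
    inside one vector space. *)
Definition spread_in (F : fieldType) (vT : vectType F) (V : {vspace vT})
    (t : nat) (s : seq {vspace vT}) : Prop :=
  [/\ uniq s,
      forall U, U \in s -> (U <= V)%VS /\ \dim U = t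
    & forall U W, U \in s -> W \in s -> U != W -> (U :&: W = 0)%VS].

Lemma count_mem_spread (F : fieldType) (vT : vectType F) (V : {vspace vT})
    (t : nat) (s : seq {vspace vT}) (v : vT) :
  spread_in V t s -> v != 0 -> (count (fun U : {vspace vT} => v \in U) s <= 1)%N.
Proof.
move=> [Us _ sI] v_neq0; rewrite -size_filter.
have := filter_uniq (fun U : {vspace vT} => v \in U) Us.
have := (mem_filter (fun U : {vspace vT} => v \in U))^~ s.
case: (filter _ s) => [|U [|W s']] //= mem_s /andP[].
rewrite inE negb_or => /andP[UW _] _.
have /andP[vU sU] : (v \in U) && (U \in s) by rewrite -mem_s mem_head.
have /andP[vW sW] : (v \in W) && (W \in s) by rewrite -mem_s !inE eqxx orbT.
by move: v_neq0; rewrite -memv0 -(sI U W) // memv_cap vU vW.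
Qed.

Lemma card_vspace_neq0 (F : finFieldType) (vT : vectType F) (U : {vspace vT}) :
  #|[pred v : finvect_type vT | (v \in U) && (v != 0 :> vT)]|
    = (#|F| ^ \dim U).-1.
Proof.
(* [vT] is convertible to its [finvect_type] alias only once destructed. *)
case: vT U => T c U; rewrite -(@card_vspace F (finvect_type (Vector.Pack c))).
rewrite [in RHS](cardD1 0) mem0v; apply: eq_card => v.
by rewrite !inE andbC.
Qed.

(** Double counting of the pairs (U, v) with v a nonzero vector of the member U: each v lies in at
    most one member. *)
Lemma spread_in_card_le (F : finFieldType) (vT : vectType F)
    (V : {vspace vT}) (t : nat) (s : seq {vspace vT}) :
  spread_in V t s -> (size s * (#|F| ^ t).-1 <= (#|F| ^ \dim V).-1)%N.
Proof.
move=> spS; have [_ dimS _] := spS; pose T := finvect_type vT.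
have -> : (size s * (#|F| ^ t).-1 =
    \sum_(U <- s) \sum_(v : T | [&& v \in V, v != 0%R :> vT & v \in U]) 1)%N.
  rewrite -sum1_size big_distrl /=; apply: eq_big_seq => U /dimS[/subvP sUV dimU].
  rewrite mul1n -dimU -card_vspace_neq0 -sum1_card; apply: eq_bigl => v; rewrite inE.
  by apply/andP/and3P => [[vU ->]|[_ -> ->]] //; rewrite (sUV _ vU).
rewrite -card_vspace_neq0 -sum1_card.
rewrite (exchange_big_dep (fun v : T => (v \in V) && (v != 0 :> vT))) /=; last first.
  by move=> U v _ /and3P[-> ->].
apply: leq_sum => v /andP[vV v_neq0].
rewrite (eq_bigl (fun U : {vspace vT} => v \in U)) => [|U]; last by rewrite vV v_neq0.
by rewrite sum1_count (count_mem_spread spS).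
Qed.

Lemma exists_subv (F : fieldType) (vT : vectType F) (V : {vspace vT}) (t : nat) :
  (t <= \dim V)%N -> exists U : {vspace vT}, (U <= V)%VS /\ \dim U = t.
Proof.
move=> tV; pose X : seq vT := take t (vbasis V); exists <<X>>%VS; split.
  by apply/span_subvP => v /mem_take; apply: vbasis_mem.
have := basis_free (vbasisP V).
rewrite -[in free _](cat_take_drop t (vbasis V)) => /catl_free.
by rewrite /free => /eqP->; rewrite size_takel // size_tuple.
Qed.

(* The new members are the graphs over a complement [V1] of [V0] of the maps
   [x |-> g (al * j x)], where [g] identifies [V0] with the field extension
   [K] of degree [\dim V0] and [j] identifies [V1] with a subspace of [K]. *)
Lemma spread_in_extend (F : finFieldType) (vT : vectType F)
    (V0 V : {vspace vT}) (t : nat) (s : seq {vspace vT}) :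
  (0 < t <= \dim V0)%N -> (V0 <= V)%VS -> \dim V = (\dim V0 + t)%N ->
  spread_in V0 t s ->
  exists s', spread_in V t s' /\ size s' = (#|F| ^ \dim V0 + size s)%N.
Proof.
move=> /andP[t_gt0 tV0] sV0V dimV [Us dimS sI].
have [K dimK] := finField_ext_exists F (leq_trans t_gt0 tV0).
pose V1 := (V :\: V0)%VS; pose W := 'rV[F]_t.
have dimV1 : \dim V1 = t.
  by have := dimv_cap_compl V V0; rewrite (capv_idPr sV0V) dimV => /addnI.
have V01 : (V1 :&: V0 = 0)%VS := capv_diff V V0.
have dimW : \dim {:W} = t by rewrite dimvf /dim /= mul1n.
have [T [_ dimT]] : exists T : {vspace K}, (T <= fullv)%VS /\ \dim T = t.
  by apply: exists_subv; rewrite dimK.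
have [g [g0 gV]] : exists g : 'Hom(K, vT), lker g = 0%VS /\ limg g = V0.
  by apply: exists_hom_lker_limg; rewrite dimv0 dimK.
have [f [f0 fV]] : exists f : 'Hom(W, vT), lker f = 0%VS /\ limg f = V1.
  by apply: exists_hom_lker_limg; rewrite dimv0 dimW dimV1.
have [j [j0 _]] : exists j : 'Hom(W, K), lker j = 0%VS /\ limg j = T.
  by apply: exists_hom_lker_limg; rewrite dimv0 dimW dimT.
pose phi (al : K) : 'Hom(W, vT) := (g \o (amull al \o j) + f)%VF.
have phiE al x : phi al x = g (al * j x) + f x.
  by rewrite add_lfunE !comp_lfunE lfunE.
have gV0 y : g y \in V0 by rewrite -gV memv_img ?memvf.
have fV1 x : f x \in V1 by rewrite -fV memv_img ?memvf.
have fV0 x : f x \in V0 -> x = 0.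
  move=> fx0; apply/eqP; rewrite -memv0 -f0 memv_ker -memv0 -V01 memv_cap.
  by rewrite fV1.
have phiV0 al x : phi al x \in V0 -> x = 0.
  by rewrite phiE rpredDl // => /fV0.
(* If [phi al x = phi be y], then [f (x - y)] lies in both [V1] and [V0], so x = y. Injectivity of
   [g] leaves (al - be) * j x = 0, and [K] has no zero divisors. *)
have phiI al be : al != be -> (limg (phi al) :&: limg (phi be) = 0)%VS.
  move=> al_be; apply/eqP; rewrite -subv0; apply/subvP => v.
  rewrite memv_cap => /andP[/memv_imgP[x _ ->] /memv_imgP[y _]].
  rewrite !phiE => E.
  have Ex : f x = g (be * j y) + f y - g (al * j x).
    by rewrite -E addrAC subrr add0r.
  have xy : x = y.
    apply/eqP; rewrite -subr_eq0; apply/eqP/fV0.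
    by rewrite linearB /= Ex addrAC addrK rpredB.
  move: E; rewrite -xy => /addIr/eqP; rewrite -subr_eq0 -linearB /= -mulrBl.
  rewrite -memv_ker g0 memv0 mulf_eq0 subr_eq0 (negPf al_be) /=.
  rewrite -memv_ker j0 memv0 => /eqP->.
  by rewrite -phiE linear0 mem0v.
have dim_phi al : \dim (limg (phi al)) = t.
  rewrite limg_dim_eq ?dimW //; apply/eqP; rewrite capfv -subv0.
  apply/subvP => x; rewrite memv_ker => /eqP phix0.
  by rewrite (phiV0 al x) ?mem0v // phix0 mem0v.
have phi0 al : (limg (phi al) :&: V0 = 0)%VS.
  apply/eqP; rewrite -subv0; apply/subvP => v.
  rewrite memv_cap => /andP[/memv_imgP[x _ ->]] /phiV0 ->.
  by rewrite linear0 mem0v.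
have cap_neq0 (U W' : {vspace vT}) : \dim U = t -> (U :&: W' = 0)%VS -> U != W'.
  move=> dimU UW; apply: contraTneq t_gt0 => UW'.
  by rewrite -dimU -(capvv U) {2}UW' UW dimv0.
(* One graph for each element of [K], hence #|F|^(dim V0) new members. *)
pose s1 := [seq limg (phi al) | al <- enum (finvect_type K)].
exists (s1 ++ s); split; last first.
  rewrite size_cat size_map -dimK -(@card_vspace F (finvect_type K)).
  by rewrite (@card_vspacef F (finvect_type K)) cardE.
have sV0 U : U \in s -> (U <= V0)%VS by case/dimS.
have s1s al U : U \in s -> (limg (phi al) :&: U = 0)%VS.
  move=> /sV0 sU; apply/eqP; rewrite -subv0 -(phi0 al); exact: capvS.
split.
- rewrite cat_uniq Us andbT; apply/andP; split.
    rewrite map_inj_uniq; first exact: (enum_uniq (finvect_type K)).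
    move=> al be E; apply/eqP/negPn/negP.
    by move=> /phiI; apply/eqP; rewrite E capvv -dimv_eq0 dim_phi -lt0n.
  apply/hasPn => U sU; apply/mapP => -[al _ E].
  by have := cap_neq0 _ _ (dim_phi al) (s1s al _ sU); rewrite E eqxx.
- move=> U; rewrite mem_cat => /orP[/mapP[al _ ->]|/dimS[sUV0 ->]].
    split=> //; apply/subvP => _ /memv_imgP[x _ ->]; rewrite phiE rpredD //.
      exact: (subvP sV0V).
    exact: (subvP (diffvSl V V0)).
  by split=> //; apply: subv_trans sV0V.
- move=> U W'; rewrite !mem_cat.
  case/orP=> [/mapP[al _ ->]|sU]; case/orP=> [/mapP[be _ ->]|sW] UW.
  + by apply: phiI; apply: contraNneq UW => ->.
  + exact: s1s.
  + by rewrite capvC; apply: s1s.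
  + exact: sI.
Qed.

(** Start from a single [t]-space in dimension t + b, which accounts for the successor in the size.
    Extending from dimension i * t + b adds the i-th term of the sum. *)
Lemma spread_in_exists (F : finFieldType) (t b k : nat) (vT : vectType F)
    (V : {vspace vT}) :
  (0 < t)%N -> \dim V = (k.+1 * t + b)%N ->
  exists s, spread_in V t s /\
    size s = (\sum_(1 <= i < k.+1) #|F| ^ (i * t + b)).+1.
Proof.
move=> t_gt0; elim: k V => [|k IHk] V dimV.
  have [|U [sUV dimU]] := @exists_subv F vT V t.
    by rewrite dimV mul1n leq_addr.
  exists [:: U]; split; last by rewrite big_geq.
  split=> // [W|W1 W2]; first by rewrite inE => /eqP->.
  by rewrite !inE => /eqP-> /eqP->; rewrite eqxx.
have [|V0 [sV0V dimV0]] := @exists_subv F vT V (k.+1 * t + b).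
  by rewrite dimV leq_add2r leq_pmul2r.
have [s [spS size_s]] := IHk V0 dimV0.
have [||s' [spS' size_s']] := spread_in_extend _ sV0V _ spS.
- by rewrite t_gt0 dimV0 mulSn -addnA leq_addr.
- by rewrite dimV dimV0 (mulSn k.+1) -addnA addnC.
exists s'; split=> //.
by rewrite size_s' size_s dimV0 [in RHS]big_nat_recr //= addnS addnC.
Qed.

(** * From partial spreads to codes *)

Lemma spread_code (F : finFieldType) (L : fieldExtType F) (vT : vectType F)
    (t : nat) (s : seq {vspace vT}) :
  (0 < t)%N -> \dim {:vT} = (\dim {:L} + t)%N -> (1 < size s)%N ->
  spread_in fullv t s ->
  exists C : {vspace {ffun 'I_(size s) -> L}},
    additive_code (\dim {:vT}) (size s).-1 C.
Proof.
move=> t_gt0 dimT s_gt1 spS; have [_ dimS _] := spS.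
pose U (i : 'I_(size s)) := tnth (in_tuple s) i.
have dimU i : \dim (U i) = t by have [] := dimS _ (mem_tnth i (in_tuple s)).
have [phi kerphi] : exists phi : 'I_(size s) -> 'Hom(vT, L),
    forall i, lker (phi i) = U i.
  apply: (fin_all_exists (P := fun i (f : 'Hom(vT, L)) => lker f = U i)) => i.
  have [|f [kf _]] := @exists_hom_lker_limg F vT L (U i) fullv; last by exists f.
  by rewrite dimU dimT addnC.
pose enc0 v : {ffun 'I_(size s) -> L} := [ffun i => phi i v].
have enc_lin : linear enc0.
  by move=> a u v; apply/ffunP => i; rewrite !ffunE linearP.
pose enc := linfun (HB.pack_for {linear vT -> {ffun 'I_(size s) -> L}} enc0
  (GRing.isLinear.Build _ _ _ _ enc0 enc_lin)).
have encE v i : enc v i = phi i v by rewrite lfunE /= ffunE.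
have wt_enc v : (wt (enc v) + count (fun W : {vspace vT} => v \in W) s = size s)%N.
  rewrite -[in RHS](card_ord (size s)) -(cardsC [set i | enc v i != 0]).
  congr (_ + _)%N; rewrite -sum1_count big_tnth -sum1_card.
  by apply: eq_bigl => i; rewrite !inE negbK encE -memv_ker kerphi.
(* A nonzero vector with zero word would lie in every member, but there are at least two members and
   it lies in at most one. *)
have enc0P v : enc v = 0 -> v = 0.
  move=> ev0; apply/eqP/negPn/negP => v_neq0.
  have := count_mem_spread spS v_neq0; rewrite leqNgt => /negP; apply.
  have wt0 : wt (enc v) = 0%N.
    apply/eqP; rewrite ev0 /wt cards_eq0 -subset0.
    by apply/subsetP => i; rewrite inE ffunE eqxx.
  by have := wt_enc v; rewrite wt0 add0n => ->.
exists (limg enc); split; last split.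
- rewrite limg_dim_eq //; apply/eqP; rewrite capfv -subv0.
  by apply/subvP => v; rewrite memv_ker => /eqP/enc0P->; rewrite mem0v.
(* A nonzero vector of any member has exactly one zero in its word, so the bound on the weight is
   attained. *)
- pose i0 := Ordinal (ltnW s_gt1); pose v := vpick (U i0).
  have v_neq0 : v != 0 by rewrite vpick0 -dimv_eq0 dimU -lt0n.
  exists (enc v); split; first by rewrite memv_img ?memvf.
    by apply: contraNneq v_neq0 => /enc0P->.
  have : count (fun W : {vspace vT} => v \in W) s = 1%N.
    apply/eqP; rewrite eqn_leq (count_mem_spread spS) // -has_count.
    by apply/hasP; exists (U i0); rewrite ?memv_pick // mem_tnth.
  by move=> cnt1; have := wt_enc v; rewrite cnt1 addn1 => /(congr1 predn).
- move=> _ /memv_imgP[v _ ->] ev_neq0.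
  have v_neq0 : v != 0 by apply: contraNneq ev_neq0 => ->; rewrite linear0.
  have := count_mem_spread spS v_neq0; have := wt_enc v.
  case: (count _ s) => [|[|]] // /(congr1 predn) E _; last by rewrite -E addn1.
  by rewrite -E addn0 leq_pred.
Qed.

(** With this value of the ceiling, being QMDS means d = N - 1. *)
Lemma ceil_add_ratio (h r0 : nat) :
  (0 < r0 <= h)%N -> Num.ceil ((h + r0)%:R / h%:R : rat) = 2.
Proof.
case/andP=> r0_gt0 r0h; have h_gt0 : (0 < h)%N := leq_trans r0_gt0 r0h.
have h0 : 0 < h%:R :> rat by rewrite ltr0n.
apply: ceil_def; rewrite ltr_pdivlMr // ler_pdivrMr //.
rewrite mul1r ltr_nat -[_ * h%:R](natrM _ 2) ler_nat mul2n -addnn leq_add2l r0h.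
by rewrite -[X in (X < _)%N]addn0 ltn_add2l r0_gt0.
Qed.

Theorem mainTheorem3 (q h r0 r N : nat) (F : finFieldType) (L : fieldExtType F)
    (hq : #|F| = q) (hL : \dim {:L} = h)
    (hh : (2 <= h)%N) (hr0 : (1 <= r0 <= h)%N) (hr : r = (h + r0)%N)
    (hN : max_partial_spread_size F r r0 N) :
  (exists (d : nat) (C : {vspace {ffun 'I_N -> L}}),
     additive_code r d C /\ QMDS N r h d) /\
  (forall (f : int) (a b : nat),
     N%:Z = (q ^ h)%N%:Z + f ->
     h = (a * r0 + b)%N -> (1 <= a)%N -> (b <= r0 - 1)%N ->
     f >= ((\sum_(1 <= i < a) q ^ (i * r0 + b)) + 1)%N%:Z /\
     ((r0 %| h)%N ->
        f = ((\sum_(1 <= i < a) q ^ (i * r0)) + 1)%N%:Z /\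
        f%:~R = (q%:R ^+ h - 1) / (q%:R ^+ r0 - 1) :> rat)).
Proof.
case/andP: hr0 => r0_gt0 r0h; have [[S [[dimS SI] cardS]] maxS] := hN.
have q_gt1 : (1 < q)%N by rewrite -hq finNzRing_gt1.
have dimT : \dim {:'rV[F]_r} = r by rewrite dimvf /dim /= mul1n.
have spS : spread_in fullv r0 (enum_fset S).
  by split=> [|U /dimS <-|]; [apply: fset_uniq | rewrite subvf|].
(* No bound on [b] is imposed, so [a] and [b] need not come from Euclidean division. *)
have lowerN a b : h = (a * r0 + b)%N ->
    (\sum_(1 <= i < a.+1) q ^ (i * r0 + b) < N)%N.
  move=> hab; have [|s [[Us dims sI] size_s]] :=
    @spread_in_exists F r0 b a _ (fullv : {vspace 'rV[F]_r}) r0_gt0.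
    by rewrite dimT hr hab mulSn addnC addnA.
  rewrite -hq -size_s -(undup_id Us) -(size_seq_fset tt); apply: maxS; split.
    by move=> U; rewrite seq_fsetE => /dims[].
  by move=> U W; rewrite !seq_fsetE; apply: sI.
split=> [|f a b Nf hab a_gt0 b_lt].
  have N_gt1 : (1 < N)%N.
    (* The choice a = 1, b = h - r0 gives N > q^h. *)
    apply: leq_trans (lowerN 1%N (h - r0)%N _); last by rewrite mul1n subnKC.
    by rewrite ltnS big_nat1 expn_gt0 ltnW.
  have size_S : size (enum_fset S) = N by [].
  have [||||C codeC] := @spread_code F L 'rV[F]_r r0 (enum_fset S).
  - by [].
  - by rewrite dimT hL.
  - by rewrite size_S.
  - by [].
  rewrite dimT size_S in C codeC.
  exists N.-1, C; split=> //.
  rewrite /QMDS hr ceil_add_ratio ?r0_gt0 //.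
  by rewrite predn_int ?(ltnW N_gt1) // -addrA.
have {}Nf : f = N%:Z - (q ^ h)%N%:Z by rewrite Nf addrAC subrr add0r.
have qh : (q ^ h = q ^ (a * r0 + b))%N by rewrite hab.
(* The last term i = a of the sum in [lowerN] is q^h, which cancels against the q^h in N. *)
have f_ge : ((\sum_(1 <= i < a) q ^ (i * r0 + b)) + 1)%N%:Z <= f.
  rewrite Nf lerBrDr -PoszD lez_nat qh addnAC -big_nat_recr //= addn1.
  exact: lowerN.
split=> // r0_dvd; have b0 : b = 0%N.
  move: r0_dvd; rewrite hab dvdn_addr ?dvdn_mull // => /eqP.
  by rewrite modn_small // -(prednK r0_gt0) ltnS -subn1.
have hE : h = (r0 * a)%N by rewrite hab b0 addn0 mulnC.
(* The term i = 0 of this geometric sum is the summand 1 of the stated formula. *)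
pose G := (\sum_(i < a) (q ^ r0) ^ i)%N.
have GE : ((\sum_(1 <= i < a) q ^ (i * r0)) + 1 = G)%N.
  rewrite /G -(big_mkord xpredT (fun i => (q ^ r0) ^ i)%N) [in RHS]big_ltn // addnC.
  by congr (_ + _)%N; apply: eq_bigr => i _; rewrite -expnM mulnC.
have Q_gt1 : (1 < q ^ r0)%N by rewrite (ltn_exp2l 0).
(* Here r = r0 * (a + 1). With Q = q^r0, counting gives N (Q - 1) <= Q^(a+1) - 1; dividing by Q - 1
   leaves 1 + Q + ... + Q^a, whose last term is q^h. *)
have N_le : (N <= G + q ^ h)%N.
  have rE : r = (r0 * a.+1)%N by rewrite hr hE addnC -mulnS.
  have := spread_in_card_le spS; rewrite hq dimT cardS [in (q ^ r)%N]rE expnM.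
  rewrite (predn_exp _ a.+1) mulnC leq_pmul2l; last by rewrite -ltnS prednK // ltnW.
  by rewrite big_ord_recr /= -expnM -hE.
have fG : f = G%:Z.
  apply/eqP; rewrite eq_le; apply/andP; split.
    by rewrite Nf lerBlDr -PoszD lez_nat.
  apply: le_trans f_ge; rewrite -GE lez_nat leq_add2r.
  by apply: leq_sum => i _; rewrite b0 addn0.
split; first by rewrite fG GE.
have natrX1 n : q%:R ^+ n - 1 = (q ^ n).-1%:R :> rat.
  by rewrite -natrX -subn1 natrB // expn_gt0 ltnW.
rewrite fG !natrX1 [in (q ^ h)%N]hE expnM predn_exp natrM [RHS]mulrC mulKf //.
by rewrite pnatr_eq0 -lt0n -ltnS prednK // ltnW.
Qed.
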